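(* Let $q$ be an indeterminate and let $m,n,r\geq 0$ and $k\ge0$ be integers. Then $$S_q^{(m+r)}(n,k)=\sum_{i=0}^n q^{m(i+r)+\binom{m}{2}}m_q^{\,n-i}\binom{n}{i}S_q^{(r)}(i,k),$$ $$L_q^{(m+r)}(n,k)=\sum_{i=0}^n q^{m(2i+2r+m-1)}[2m]_q^{\overline{n-i}}\binom{n}{i}_qL_q^{(r)}(i,k),$$ and $$c_q^{(m+r)}(n,k)=\sum_{i=0}^n q^{r(n-i)}m_q^{\overline{n-i}}\binom{n}{i}_qc_q^{(r)}(i,k).$$
   Context: For an integer $a\ge1$, $a_q=[a]_q=1+q+\cdots+q^{a-1}$, $0_q=0$, $a_q!=\prod_{i=1}^a i_q$, $0_q!=1$; $\binom{n}{k}_q=\frac{n_q!}{k_q!(n-k)_q!}$ for $0\le k\le n$, $\binom{n}{0}_q=1$ for all $n$, $0$ otherwise; $[a]_q^{\overline{b}}=\prod_{i=a}^{a+b-1}i_q$ for $b\ge1$, $[a]_q^{\overline{0}}=1$. Inversions of a word: pairs of positions $s<t$ with the letter at $s$ larger than that at $t$. (Partitions) For a set partition $\pi=B_1/\cdots/B_k$ with $\min B_1<\cdots<\min B_k$, $w(\pi)=\sum_{i=1}^k(i-1)|B_i|$. For $s\ge0$, $S_q^{(s)}(n,k)=\sum q^{w(\pi)}$ over partitions $\pi$ of $[n+s]$ into $k+s$ blocks with $1,\dots,s$ in distinct blocks. (Lah distributions) A Lah distribution is a set partition with each block linearly ordered. For one with $k$ blocks, write the blocks as words $W_1,\dots,W_k$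 in decreasing order of least elements and let $\mathrm{inv}_\rho$ be the number of inversions of $W_1\,0\,W_2\,0\cdots0\,W_k$. For $s\ge0$, $L_q^{(s)}(n,k)=\sum q^{\mathrm{inv}_\rho(\delta)}$ over Lah distributions $\delta$ of $[n+s]$ into $k+s$ blocks with $1,\dots,s$ in distinct blocks. (Permutations) Write a permutation in standard cycle form (each cycle begins with its minimum, cycles ordered by increasing minima), erase cycle dividers, and let $\mathrm{inv}_c$ be the number of inversions of the resulting word. For $s\ge0$, $c_q^{(s)}(n,k)=\sum q^{\mathrm{inv}_c(\pi)}$ over permutations $\pi$ of $[n+s]$ with $k+s$ cycles and $1,\dots,s$ in distinct cycles. *)

(* Defs.v *)
From HB Require Import structures.
From mathcomp Require Import all_boot all_order all_fingroup all_algebra.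
From mathcomp Require Import ring.

Set Implicit Arguments.
Unset Strict Implicit.
Unset Printing Implicit Defensive.

Import GRing.Theory.

Local Open Scope ring_scope.

(* The indeterminate q is the variable 'X of {poly int}. *)

Definition qnum (a : nat) : {poly int} := \sum_(i < a) 'X^i.

Definition qfact (a : nat) : {poly int} := \prod_(1 <= i < a.+1) qnum i.

Definition qrising (a b : nat) : {poly int} := \prod_(a <= i < a + b) qnum i.

(* The divisor is monic and the division exact: see qbinomE below. *)
Definition qbinom (n k : nat) : {poly int} :=
  if (k <= n)%N then qfact n %/ (qfact k * qfact (n - k)) else 0.

Definition inv (w : seq nat) : nat :=
  #|[set p : 'I_(size w) * 'I_(size w) |
      (p.1 < p.2)%N && (nth 0%N w p.2 < nth 0%N w p.1)%N]|.

(* The ground set [N] = {1, ..., N} is 'I_N, with x : 'I_N standing for x + 1;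
   in particular the elements 1, ..., s are the x with x < s. *)

Definition distinct_blocks (N s : nat) (P : {set {set 'I_N}}) : bool :=
  [forall x : 'I_N, forall y : 'I_N,
     [&& x < s, y < s & x != y]%N ==> (pblock P x != pblock P y)].

Definition minb (N : nat) (B : {set 'I_N}) : nat :=
  \big[minn/N]_(x in B) (x : nat).

Definition blocks (N : nat) (P : {set {set 'I_N}}) : seq {set 'I_N} :=
  sort (fun B C => minb B <= minb C)%N (enum P).

Definition wpart (N : nat) (P : {set {set 'I_N}}) : nat :=
  (\sum_(i < size (blocks P)) i * #|nth set0 (blocks P) i|)%N.

Definition Sq (s n k : nat) : {poly int} :=
  \sum_(P : {set {set 'I_(n + s)}} |
        [&& partition P [set: 'I_(n + s)], #|P| == (k + s)%N
          & distinct_blocks s P])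
    'X^(wpart P).

(* Lah distributions: a linearly ordered block is a duplicate-free word, and a
   Lah distribution is a set of such words whose supports are the blocks of a
   set partition, each block being the support of just one of the words. *)

Definition supp (N : nat) (W : N.-bseq 'I_N) : {set 'I_N} := [set x in W].

Definition underlying (N : nat) (D : {set N.-bseq 'I_N}) : {set {set 'I_N}} :=
  [set supp W | W in D].

Definition is_lah (N : nat) (D : {set N.-bseq 'I_N}) : bool :=
  [&& partition (underlying D) [set: 'I_N],
      [forall W in D, uniq W]
    & [forall V in D, forall W in D, (supp V == supp W) ==> (V == W)]].

Definition lah_words (N : nat) (D : {set N.-bseq 'I_N}) : seq (N.-bseq 'I_N) :=
  sort (fun V W => minb (supp V) >= minb (supp W))%N (enum D).

(* W_1 0 W_2 0 ... 0 W_k, the letters of the W_i being shifted to 1, ..., N. *)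
Definition lah_word (N : nat) (D : {set N.-bseq 'I_N}) : seq nat :=
  behead (flatten
    [seq 0%N :: [seq (val x).+1 | x <- val W] | W <- lah_words D]).

Definition Lq (s n k : nat) : {poly int} :=
  \sum_(D : {set (n + s).-bseq 'I_(n + s)} |
        [&& is_lah D, #|D| == (k + s)%N & distinct_blocks s (underlying D)])
    'X^(inv (lah_word D)).

(* enum 'I_N is increasing, so the cycles come by increasing minima. *)
Definition cycle_minima (N : nat) (p : {perm 'I_N}) : seq 'I_N :=
  [seq x <- enum 'I_N | [forall y in porbit p x, x <= y]%N].

Definition cycle_word (N : nat) (p : {perm 'I_N}) : seq nat :=
  flatten [seq [seq val y | y <- traject p x #|porbit p x|]
             | x <- cycle_minima p].

Definition cq (s n k : nat) : {poly int} :=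
  \sum_(p : {perm 'I_(n + s)} |
        (#|porbits p| == (k + s)%N) && distinct_blocks s (porbits p))
    'X^(inv (cycle_word p)).

Lemma qnumS (a : nat) : qnum a.+1 = qnum a + 'X^a.
Proof. by rewrite /qnum big_ord_recr. Qed.

Lemma qnumD (a b : nat) : qnum (a + b) = qnum a + 'X^a * qnum b.
Proof.
elim: b => [|b IH]; first by rewrite addn0 /qnum big_ord0 mulr0 addr0.
by rewrite addnS !qnumS IH mulrDr -exprD addrA.
Qed.

Lemma qfact0 : qfact 0 = 1.
Proof. by rewrite /qfact big_geq. Qed.

Lemma qfactS (a : nat) : qfact a.+1 = qfact a * qnum a.+1.
Proof. by rewrite /qfact big_nat_recr. Qed.

Lemma qnum_monic (a : nat) : qnum a.+1 \is monic.
Proof.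
have -> : qnum a.+1 = \poly_(i < a.+1) 1.
  by rewrite poly_def; apply: eq_bigr => i _; rewrite scale1r.
by rewrite monicE lead_coef_poly ?oner_eq0.
Qed.

Lemma qfact_monic (a : nat) : qfact a \is monic.
Proof.
elim: a => [|a IH]; first by rewrite qfact0 rpred1.
by rewrite qfactS rpredM ?qnum_monic.
Qed.

Lemma qbinom_exact (a b : nat) :
  exists g : {poly int}, qfact (a + b) = g * (qfact a * qfact b).
Proof.
have [n] := ubnP (a + b); elim: n a b => // n IH [|a] [|b] ltn.
- by exists 1; rewrite qfact0 !mulr1.
- by exists 1; rewrite qfact0 !mul1r.
- by exists 1; rewrite qfact0 addn0 mulr1 mul1r.
have [|g Eg] := IH a b.+1; first by rewrite addSn in ltn.
have [|h Eh] := IH a.+1 b; first by rewrite addnS in ltn.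
exists (g + 'X^(a.+1) * h); rewrite addSn qfactS -addSn qnumD mulrDr.
rewrite {1}Eg addnS -addSn Eh (qfactS a) (qfactS b).
by ring.
Qed.

Lemma qbinomE (n k : nat) : (k <= n)%N ->
  qbinom n k * (qfact k * qfact (n - k)) = qfact n.
Proof.
move=> le_kn; rewrite /qbinom le_kn.
have [g] := qbinom_exact k (n - k); rewrite subnKC // => ->.
by rewrite Pdiv.IdomainMonic.mulpK // rpredM ?qfact_monic.
Qed.

(* Main.v *)
Require Import Defs.
From mathcomp Require Import all_boot all_order all_fingroup all_algebra.
From mathcomp Require Import zify ring.

(** Each of the three structures on [N] is encoded by the list of its blocks,
    written as words and ordered by increasing minima.  Deleting the largest
    letter N turns such a list into one for N - 1; conversely N either forms a
    new last block or is inserted somewhere in an existing block.  Following the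
    statistic through the insertion gives, with K blocks in total,

      A (N + 1, K) = q^(a N (K - 1)) A (N, K - 1) + [b N K]_q A (N, K),

    the second term being absent while N < s, since the first s elements lie in
    distinct blocks.  Here (a N K, b N K) is (K, K) for partitions,
    (N + K, N + K) for Lah distributions and (0, N) for permutations.  The
    Pascal recurrence, ordinary or q-analogue, makes the right-hand sides of
    the theorem satisfy the recurrence of the left-hand sides. *)

Set Implicit Arguments.
Unset Strict Implicit.
Unset Printing Implicit Defensive.

Import GRing.Theory.

Local Open Scope ring_scope.

(** * Ordered lists of blocks *)

(* For nonempty words this says that the minimum of [c] is less than that of
   [d]; no default value is needed for the minimum of an empty word. *)
Definition min_lt (c d : seq nat) : bool := has (fun x => all (ltn x) d) c.

Lemma min_lt_trans : transitive min_lt.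
Proof.
move=> d c e /hasP[x xc /allP xd] /hasP[y yd /allP ye].
apply/hasP; exists x => //; apply/allP => z /ye /=.
exact/ltn_trans/xd.
Qed.

Lemma min_lt_irr : irreflexive min_lt.
Proof.
by move=> c; apply/negbTE/hasP => -[x xc /allP/(_ x xc)]; rewrite /= ltnn.
Qed.

(** [pairwise] rather than [sorted], so that the order condition splits over concatenations. *)
Definition canon (N : nat) (L : seq (seq nat)) : bool :=
  [&& perm_eq (flatten L) (iota 0 N), pairwise min_lt L & [::] \notin L].

(** Every place is allowed, even the front of a word: the shape of the words is imposed later by the
    predicate [C] of [csum], so that one generator serves all three structures. *)
Fixpoint insb (N : nat) (L : seq (seq nat)) : seq (seq (seq nat)) :=
  if L is c :: L' then
    [seq (take i c ++ N :: drop i c) :: L' | i <- iota 0 (size c).+1]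
      ++ [seq c :: M | M <- insb N L']
  else [::].

Arguments insb : simpl never.

Lemma insb_cons N c L :
  insb N (c :: L) =
    [seq (take i c ++ N :: drop i c) :: L | i <- iota 0 (size c).+1]
      ++ [seq c :: M | M <- insb N L].
Proof. by []. Qed.

Fixpoint gen (N : nat) : seq (seq (seq nat)) :=
  if N is N'.+1 then
    flatten [seq rcons L [:: N'] :: insb N' L | L <- gen N']
  else [:: [::]].

Variant insb_spec (N : nat) (L M : seq (seq nat)) : Prop :=
  InsbSpec L1 c1 c2 L2 of L = L1 ++ (c1 ++ c2) :: L2
    & M = L1 ++ (c1 ++ N :: c2) :: L2.

Lemma insbP N L M : reflect (insb_spec N L M) (M \in insb N L).
Proof.
apply: (iffP idP).
  elim: L M => // c L IH M; rewrite insb_cons mem_cat => /orP[] /mapP[].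
    move=> i _ ->; exists [::] (take i c) (drop i c) L => //=.
    by rewrite cat_take_drop.
  move=> M' /IH[L1 c1 c2 L2 -> ->] ->.
  by exists (c :: L1) c1 c2 L2.
case=> L1 c1 c2 L2 -> ->; elim: L1 => [|c L1 IH]; rewrite /= insb_cons mem_cat.
  apply/orP; left; apply/mapP; exists (size c1).
    by rewrite mem_iota size_cat; lia.
  by rewrite take_size_cat // drop_size_cat.
by apply/orP; right; apply/mapP; eexists; first exact: IH.
Qed.

Lemma size_insb N L M : M \in insb N L -> size M = size L.
Proof. by case/insbP=> L1 c1 c2 L2 -> ->; rewrite !size_cat. Qed.

Lemma canon_uniq N L : canon N L -> uniq (flatten L).
Proof. by case/and3P=> /perm_uniq-> _ _; rewrite iota_uniq. Qed.

Lemma canon_mem N L x : canon N L -> (x \in flatten L) = (x < N)%N.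
Proof. by case/and3P=> /perm_mem-> _ _; rewrite mem_iota add0n. Qed.

Lemma canon_lt N L c x : canon N L -> c \in L -> x \in c -> (x < N)%N.
Proof.
by move=> cL cinL xc; rewrite -(canon_mem _ cL); apply/flattenP; exists c.
Qed.

Lemma canon_size N L : canon N L -> size (flatten L) = N.
Proof. by case/and3P=> /perm_size-> _ _; rewrite size_iota. Qed.

Lemma canon_block N L c : canon N L -> c \in L -> c != [::].
Proof. by case/and3P=> _ _ h cL; apply: contraNneq h => <-. Qed.

Lemma canon_block_uniq N L c : canon N L -> c \in L -> uniq c.
Proof.
move=> /canon_uniq + /splitPr cL; case: cL => p1 p2.
by rewrite flatten_cat /= !cat_uniq => /and3P[_ _ /andP[]].
Qed.

Lemma flatten_insert (T : eqType) (x : T) L1 c1 c2 L2 :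
  perm_eq (flatten (L1 ++ (c1 ++ x :: c2) :: L2))
          (x :: flatten (L1 ++ (c1 ++ c2) :: L2)).
Proof.
rewrite !flatten_cat /= -!catA /= ![flatten L1 ++ c1 ++ _]catA.
by rewrite -[x :: c2 ++ _]cat1s perm_catCA.
Qed.

Lemma perm_iotaS (N : nat) (l : seq nat) :
  perm_eq (N :: l) (iota 0 N.+1) = perm_eq l (iota 0 N).
Proof.
have -> : iota 0 N.+1 = rcons (iota 0 N) N by rewrite -addn1 iotaD cats1.
by rewrite (permPr (permEl (perm_rcons _ _))) perm_cons.
Qed.

Lemma min_lt_insr N c d1 d2 : all (ltn^~ N) c ->
  min_lt c (d1 ++ N :: d2) = min_lt c (d1 ++ d2).
Proof.
move=> /allP cN; apply: eq_in_has => x /cN /= xN.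
by rewrite !all_cat /= xN.
Qed.

(** The letter N is never the witness, being above some letter of [d]; an empty [d] would admit
    it. *)
Lemma min_lt_delete N c1 c2 d : d != [::] -> all (ltn^~ N) d ->
  min_lt (c1 ++ N :: c2) d = min_lt (c1 ++ c2) d.
Proof.
case: d => // y d _ /= /andP[yN _].
by rewrite /min_lt !has_cat /= ltnNge (ltnW yN).
Qed.

(** A largest letter does not change the minimum of a word that has another letter, so the blocks
    stay in order. A word made of N alone is left to [canon_rcons]. *)
Lemma canon_insert N L1 c1 c2 L2 : c1 ++ c2 != [::] ->
  canon N.+1 (L1 ++ (c1 ++ N :: c2) :: L2) = canon N (L1 ++ (c1 ++ c2) :: L2).
Proof.
move=> c0; rewrite /canon (permPl (flatten_insert _ _ _ _ _)) perm_iotaS.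
case h: (perm_eq _ _) => //=.
have e0 : ([::] == c1 ++ N :: c2) = false by case: c1 {c0 h}.
rewrite !mem_cat !inE e0 [_ == c1 ++ c2]eq_sym (negbTE c0) /=.
have [|n1] := boolP (_ \in L1); first by rewrite !andbF.
have [|n2] := boolP (_ \in L2); first by rewrite !andbF.
rewrite /= !andbT.
have lt c : c \in L1 ++ (c1 ++ c2) :: L2 -> all (ltn^~ N) c.
  move=> cL; apply/allP => x xc /=.
  have : x \in flatten (L1 ++ (c1 ++ c2) :: L2) by apply/flattenP; exists c.
  by rewrite (perm_mem h) mem_iota.
rewrite !pairwise_cat !pairwise_cons !allrel_consr; congr [&& _ && _, _, _ & _].
- apply: eq_in_all => c cL1 /=; rewrite min_lt_insr //.
  by apply: lt; rewrite mem_cat cL1.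
- apply: eq_in_all => d dL2 /=; rewrite min_lt_delete //.
    by apply: contraNneq n2 => <-.
  by apply: lt; rewrite mem_cat inE dL2 !orbT.
Qed.

Lemma canon_rcons N L : canon N.+1 (rcons L [:: N]) = canon N L.
Proof.
rewrite /canon -cats1 flatten_cat /= (permPl (permEl (perm_catC _ _))) /=.
rewrite perm_iotaS pairwise_cat /= andbT mem_cat inE orbF.
case h: (perm_eq _ _) => //=.
have [|n1] := boolP (_ \in L); first by rewrite !andbF.
rewrite !andbT; case: pairwise; rewrite ?andbF ?andbT //.
apply/allrelP => c d cL; rewrite inE => /eqP->.
case: c cL => [/(negP n1)//|x c cL].
rewrite /min_lt /= andbT; apply/orP; left.
have : x \in flatten L by apply/flattenP; exists (x :: c); rewrite ?mem_head.
by rewrite (perm_mem h) mem_iota.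
Qed.

Lemma gen_canon N L : (L \in gen N) = canon N L.
Proof.
elim: N L => [|N IH] L.
  rewrite inE /canon /=; case: L => [|[|x c] L] //=.
    by rewrite !andbF.
  by apply/esym/negbTE; rewrite negb_and; apply/orP; left;
    apply/negP => /perm_size.
apply/flatten_mapP/idP => [[M]|].
  rewrite IH inE => cM /orP[/eqP->|]; first by rewrite canon_rcons.
  case/insbP=> L1 c1 c2 L2 eM ->; rewrite eM in cM.
  rewrite canon_insert // (canon_block cM) //.
  by rewrite mem_cat mem_head orbT.
move=> cL; have : N \in flatten L by rewrite (canon_mem _ cL).
case/flattenP=> c cinL Nc.
case/splitPr: cinL cL => L1 L2; case/splitPr: Nc => c1 c2 cL.
(* Either N has company in its block and was inserted there, or it is alone and its block must be
   the last one. *)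
have [e|c0] := eqVneq (c1 ++ c2) [::]; last first.
  exists (L1 ++ (c1 ++ c2) :: L2); first by rewrite IH -canon_insert.
  by rewrite inE; apply/orP; right; apply/insbP; exists L1 c1 c2 L2.
case: c1 c2 e cL => [|//] [|//] _ /= cL.
(* A block after [[:: N]] is nonempty and could only have letters above N, against [canon_lt]. *)
have e2 : L2 = [::].
  case: L2 cL => // d L2 cL; exfalso.
  have dL : d \in L1 ++ [:: N] :: d :: L2 by rewrite mem_cat !inE eqxx !orbT.
  case/and3P: (cL) => _ + _;
    rewrite pairwise_cat !pairwise_cons => /and4P[_ _ + _].
  rewrite /= => /andP[+ _]; rewrite /min_lt /= orbF => /allP Nd.
  case: d cL dL Nd (canon_block cL dL) => // x d cL dL Nd _.
  move: (Nd x (mem_head _ _)) (canon_lt cL dL (mem_head _ _)) => /=; lia.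
move: cL; rewrite e2 cats1 canon_rcons => cL.
by exists L1; rewrite ?IH ?mem_head.
Qed.

(** The map [g] tells from an entry of [f x] which [x] it came from, so the lists [f x] are
    disjoint. *)
Lemma uniq_flatten_map (S T : eqType) (f : S -> seq T) (g : T -> S) s :
    uniq s -> {in s, forall x, uniq (f x)} ->
    {in s, forall x, {in f x, forall y, g y = x}} ->
  uniq (flatten [seq f x | x <- s]).
Proof.
elim: s => //= x s IH /andP[xs us] uf fg.
rewrite cat_uniq uf ?mem_head //= IH //; last 2 first.
- by move=> y ys; apply: uf; rewrite inE ys orbT.
- by move=> y ys; apply: fg; rewrite inE ys orbT.
rewrite andbT; apply/hasPn => z /flatten_mapP[y ys zy]; apply/negP => zx.
move: xs; rewrite -(fg x (mem_head _ _) z zx).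
by rewrite (fg y) ?ys // inE ys orbT.
Qed.

Lemma uniq_insb N L : N \notin flatten L -> uniq (insb N L).
Proof.
elim: L => // c L IH.
rewrite insb_cons cat_uniq -[flatten _]/(c ++ flatten L) mem_cat negb_or.
case/andP=> Nc NL;  apply/and3P; split.
- rewrite map_inj_in_uniq ?iota_uniq // => i j.
  rewrite !mem_iota => hi hj [] /(congr1 (index N)).
  (* The place of insertion is recovered as the index of N, which [c] does not contain. *)
  have ix k : (k < 0 + (size c).+1)%N ->
      index N (take k c ++ N :: drop k c) = k.
    move=> hk; rewrite index_cat (negbTE (contra (@mem_take _ _ _ _) Nc)).
    by rewrite /= eqxx addn0 size_takel //; lia.
  by rewrite !ix.
(* Insertion in the first word changes it, insertion further on does not. *)
- apply/hasPn => M /mapP[M' _ ->]; apply/mapP => -[i _ [ec _]].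
  by move: Nc; rewrite ec mem_cat mem_head orbT.
- by rewrite map_inj_uniq ?IH // => x y [].
Qed.

(* A left inverse of the insertion of N, making [gen] duplicate-free. *)
Definition strip (N : nat) (M : seq (seq nat)) : seq (seq nat) :=
  [seq c <- [seq [seq x <- c | x != N] | c <- M] | c != [::]].

Lemma gen_uniq N : uniq (gen N).
Proof.
elim: N => // N IH /=; apply: (uniq_flatten_map (g := strip N)) => // L.
  rewrite gen_canon => cL /=.
  rewrite uniq_insb ?(canon_mem _ cL) ?ltnn // andbT.
  (* A new block raises the number of blocks, an insertion keeps it. *)
  by apply/negP => /size_insb; rewrite size_rcons => /esym/n_Sn.
rewrite gen_canon => cL.
have fid c : c \in L -> [seq x <- c | x != N] = c.
  move=> cinL; apply/all_filterP/allP => x /(canon_lt cL cinL).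
  by rewrite ltn_neqAle => /andP[].
have sL : strip N L = L.
  rewrite /strip (_ : [seq _ | c <- L] = L).
    by apply/all_filterP/allP => c; apply: canon_block cL.
  by rewrite -[RHS]map_id; apply/eq_in_map.
move=> M; rewrite inE => /orP[/eqP->|/insbP[L1 c1 c2 L2 eL ->]].
  by rewrite -[RHS]sL /strip map_rcons filter_rcons /= eqxx.
by rewrite -[RHS]sL eL /strip !map_cat /= !filter_cat /= eqxx.
Qed.

(** * The insertion recurrence *)

Definition separated (s : nat) (c : seq nat) : bool :=
  all2rel (fun x y => (x < s)%N && (y < s)%N ==> (x == y)) c.

(** The word already has a letter, which is below N; were N below s, the two would be distinct
    letters below s in one word. *)
Lemma separated_insert s N c1 c2 :
    c1 ++ c2 != [::] -> all (ltn^~ N) (c1 ++ c2) ->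
  separated s (c1 ++ N :: c2) = (s <= N)%N && separated s (c1 ++ c2).
Proof.
move=> c0 /allP ltN.
have mem x : x \in c1 ++ N :: c2 = (x == N) || (x \in c1 ++ c2).
  by rewrite !mem_cat inE orbCA.
apply/allrelP/andP => [h|[sN /allrelP h] x y].
  split; last by apply/allrelP => x y hx hy; apply: h; rewrite mem ?hx ?hy orbT.
  case: (c1 ++ c2) c0 ltN mem => // x c _ ltN mem.
  have xN : (x < N)%N := ltN x (mem_head _ _).
  have := h x N; rewrite !mem eqxx mem_head orbT => /(_ isT isT) /implyP; lia.
rewrite !mem => /orP[/eqP->|hx] /orP[/eqP->|hy]; rewrite ?eqxx ?implybT //.
- by rewrite ltnNge sN.
- by rewrite [(N < s)%N]ltnNge sN andbF.
- exact: h.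
Qed.

(** The common form of the three generating functions. [N] and [K] count all letters and all blocks,
    so they stand for [n + s] and [k + s] of the theorem. *)
Definition csum (C : pred (seq nat)) (w : seq (seq nat) -> nat)
    (s N K : nat) : {poly int} :=
  \sum_(L <- gen N | [&& all C L, all (separated s) L & size L == K]) 'X^(w L).

Section Recurrence.

Variables (C : pred (seq nat)) (w : seq (seq nat) -> nat).
Variables (a b : nat -> nat -> nat).

(** By [C1] a new block is always admissible, and by [C_delete] an admissible list only arises from
    an admissible one. In the two conditions on [w], [size L] is the number of blocks before N
    enters. *)
Hypothesis C1 : forall N, C [:: N].
Hypothesis C_delete : forall N c1 c2, c1 ++ c2 != [::] ->
  all (ltn^~ N) (c1 ++ c2) -> C (c1 ++ N :: c2) -> C (c1 ++ c2).
Hypothesis w_rcons : forall N L, canon N L ->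
  w (rcons L [:: N]) = (w L + a N (size L))%N.
Hypothesis w_insb : forall N L, canon N L -> all C L ->
  \sum_(M <- insb N L | all C M) 'X^(w M) = 'X^(w L) * qnum (b N (size L)).

Lemma all_insb N L M : canon N L -> M \in insb N L -> all C M -> all C L.
Proof.
move=> cL /insbP[L1 c1 c2 L2 eL ->]; rewrite eL in cL *.
have cin : c1 ++ c2 \in L1 ++ (c1 ++ c2) :: L2 by rewrite mem_cat mem_head orbT.
rewrite !all_cat /= => /and3P[-> h ->]; rewrite andbT /=.
apply: C_delete h; first exact: canon_block cL cin.
by apply/allP => x; apply: canon_lt cL cin.
Qed.

Lemma separated_insb s N L M : canon N L -> M \in insb N L ->
  all (separated s) M = (s <= N)%N && all (separated s) L.
Proof.
move=> cL /insbP[L1 c1 c2 L2 eL ->]; rewrite eL in cL *.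
have cin : c1 ++ c2 \in L1 ++ (c1 ++ c2) :: L2 by rewrite mem_cat mem_head orbT.
rewrite !all_cat /= separated_insert ?(canon_block cL cin) //.
  by case: (s <= N)%N; rewrite //= andbF.
by apply/allP => x; apply: canon_lt cL cin.
Qed.

Lemma csumS s N K :
  csum C w s N.+1 K =
    (if K is K'.+1 then 'X^(a N K') * csum C w s N K' else 0) +
    (if (s <= N)%N then qnum (b N K) * csum C w s N K else 0).
Proof.
pose P L := all C L && all (separated s) L.
(* The share of each [L]: its extension by a new last block, when [L] has K - 1 blocks, and its
   insertions, when [L] has K blocks. *)
transitivity (\sum_(L <- gen N)
    ((if P L && ((size L).+1 == K) then 'X^(a N K.-1) * 'X^(w L) else 0) +
     (if [&& (s <= N)%N, P L & size L == K] then qnum (b N K) * 'X^(w L)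
      else 0)) : {poly int}).
  rewrite /csum /= big_flatten big_map; apply: eq_big_seq => L.
  rewrite gen_canon => cL; rewrite big_cons !all_rcons C1 size_rcons -/(P _) /=.
  have -> : separated s [:: N] by rewrite /separated /allrel /= eqxx implybT.
  rewrite /= andbA -/(P L).
  set S2 := (X in if _ then _ + X else X).
  have -> : S2 = if [&& (s <= N)%N, P L & size L == K]
                 then qnum (b N K) * 'X^(w L) else 0.
    rewrite /S2 big_seq_cond.
    (* Admissibility of [M] implies that of [L], so all the other conditions can be read off [L]. *)
    rewrite (eq_bigl (fun M => [&& (s <= N)%N, P L & size L == K] &&
                        ((M \in insb N L) && all C M))); last first.
      move=> M; have [Min|] := boolP (M \in insb N L); last by rewrite andbF.
      rewrite /= (separated_insb _ cL Min) (size_insb Min) /P.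
      have := all_insb cL Min; case: (all C M) => [->//|]; rewrite ?andbF //.
      by rewrite /= andbT andbA.
    case: ifP => [/and3P[sN /andP[PL _] /eqP <-]|_]; last by rewrite big_pred0.
    by rewrite mulrC -w_insb // -big_seq_cond.
  case: ifP => [/andP[_ /eqP <-]|_]; last by rewrite add0r.
  by rewrite w_rcons // exprD mulrC.
rewrite big_split /=; congr (_ + _).
  case: K => [|K]; first by rewrite big1 // => L _; rewrite andbF.
  rewrite /csum mulr_sumr [RHS]big_mkcond /=; apply: eq_bigr => L _.
  by rewrite /P -andbA eqSS.
case: (s <= N)%N; last by rewrite big1.
rewrite /csum mulr_sumr [RHS]big_mkcond /=; apply: eq_bigr => L _.
by rewrite /P -andbA.
Qed.

Hypothesis w0 : w [::] = 0%N.

Lemma csum0 s K : csum C w s 0 K = (K == 0%N)%:R.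
Proof.
by rewrite /csum big_cons big_nil /= w0 eq_sym; case: eqP; rewrite ?addr0.
Qed.

(** The first s letters must all open blocks, so only the list of singletons survives; letter j
    meets j blocks, whence the exponent [a j j]. *)
Lemma csum_base s N K : (N <= s)%N ->
  csum C w s N K = if K == N then 'X^(\sum_(j < N) a j j) else 0.
Proof.
elim: N K => [|N IH] K Ns; first by rewrite csum0 big_ord0; case: eqP.
rewrite csumS [(s <= N)%N]leqNgt Ns addr0.
case: K => [|K] //; rewrite IH 1?ltnW // eqSS; case: eqP => [->|];
  last by rewrite mulr0.
by rewrite big_ord_recr /= addnC exprD.
Qed.

(** The s smallest letters occupy s different blocks. *)
Lemma csum_small s N K : (s <= N)%N -> (K < s)%N -> csum C w s N K = 0.
Proof.
elim: N K => [|N IH] K; first by case: s.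
rewrite leq_eqVlt => /orP[/eqP-> lt|sN Ks].
  by rewrite csum_base // (ltn_eqF lt).
rewrite csumS -ltnS sN IH // mulr0 addr0.
by case: K Ks => // K Ks; rewrite IH ?mulr0 // ltnW.
Qed.

Lemma csum_addS s n k :
  csum C w s (n.+1 + s) (k + s) =
    (if k is k'.+1 then 'X^(a (n + s) (k' + s)) * csum C w s (n + s) (k' + s)
     else 0) +
    qnum (b (n + s) (k + s)) * csum C w s (n + s) (k + s).
Proof.
rewrite addSn csumS leq_addl; case: k => [|k] //; congr (_ + _).
(* For k = 0 and positive s, [csumS] leaves a term with s - 1 blocks, which vanishes. *)
rewrite add0n; case: s => // s; rewrite csum_small ?mulr0 //; lia.
Qed.

End Recurrence.

(** * Statistics under insertion *)

Lemma big_insb_cons (P : pred (seq (seq nat))) (F : seq (seq nat) -> {poly int})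
    N c L :
  \sum_(M <- insb N (c :: L) | P M) F M =
    \sum_(i <- iota 0 (size c).+1 | P ((take i c ++ N :: drop i c) :: L))
       F ((take i c ++ N :: drop i c) :: L) +
    \sum_(M <- insb N L | P (c :: M)) F (c :: M).
Proof. by rewrite insb_cons big_cat !big_map. Qed.

(** * Inversions of words *)

Lemma invE w :
  Defs.inv w = (\sum_(i < size w) \sum_(j < size w)
             ((i < j) && (nth 0 w j < nth 0 w i) : nat))%N.
Proof.
rewrite /Defs.inv -sum1dep_card big_mkcond pair_bigA /=.
by apply: eq_bigr => -[i j] _ /=; case: ifP.
Qed.

Lemma inv_cons x u : Defs.inv (x :: u) = (count (ltn^~ x) u + Defs.inv u)%N.
Proof.
rewrite !invE /= big_ord_recl; congr addn.
  rewrite big_ord_recl /= add0n -sum1_count (big_nth 0%N) big_mkord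
    [RHS]big_mkcond.
  by apply: eq_bigr => j _ /=; case: ltnP.
by apply: eq_bigr => i _; rewrite big_ord_recl.
Qed.

Lemma inv_nil : Defs.inv [::] = 0%N.
Proof. by rewrite invE big_ord0. Qed.

Lemma inv0s u : Defs.inv (0%N :: u) = Defs.inv u.
Proof. by rewrite inv_cons (eq_count (a2 := pred0)) ?count_pred0. Qed.

(** A largest letter is inverted with every letter after it and with none before it. *)
Lemma inv_insert x u v : all (ltn^~ x) (u ++ v) ->
  Defs.inv (u ++ x :: v) = (Defs.inv (u ++ v) + size v)%N.
Proof.
elim: u => [|y u IH] /=.
  by rewrite inv_cons all_count => /eqP->; rewrite addnC.
case/andP=> yx /IH h; rewrite !inv_cons h !count_cat /= ltnNge (ltnW yx) /=.
by rewrite add0n addnA.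
Qed.

(** The exponent counts the letters of a block that come after place i. Lah words use a = 0; cycles
    use a = 1, the front being forbidden. *)
Lemma sumXn_iota a n : \sum_(i <- iota a n) 'X^(a + n - i.+1) = qnum n.
Proof.
elim: n a => [|n IH] a; first by rewrite big_nil /qnum big_ord0.
rewrite big_cons qnumS addrC; congr (_ + 'X^_); last by lia.
by rewrite -(IH a.+1); apply: eq_bigr => i _; congr 'X^_; lia.
Qed.

(* The words of a Lah distribution are taken by decreasing minima, whence [rev];
   the extra leading 0 creates no inversion. *)
Definition lah_list_word (L : seq (seq nat)) : seq nat :=
  flatten [seq 0%N :: [seq x.+1 | x <- c] | c <- rev L].

Lemma lah_list_word_cat A c L :
  lah_list_word (A ++ c :: L) =
    lah_list_word L ++ (0%N :: [seq x.+1 | x <- c]) ++ lah_list_word A.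
Proof.
by rewrite /lah_list_word rev_cat rev_cons map_cat map_rcons flatten_cat
  flatten_rcons -catA.
Qed.

Lemma size_lah_list_word L :
  size (lah_list_word L) = (size (flatten L) + size L)%N.
Proof.
elim/last_ind: L => // L c IH.
rewrite /lah_list_word rev_rcons /= size_cat size_map -/(lah_list_word L) IH.
by rewrite flatten_rcons size_cat size_rcons; lia.
Qed.

Lemma all_lah_list_word N L : all (all (ltn^~ N)) L ->
  all (ltn^~ N.+1) (lah_list_word L).
Proof.
move=> /allP LN; apply/allP => y /flatten_mapP[c]; rewrite mem_rev => cL.
rewrite inE => /orP[/eqP->//|/mapP[x xc ->]].
exact: (allP (LN c cL)).
Qed.

Lemma canon_all N L : canon N L -> all (all (ltn^~ N)) L.
Proof.
by move=> cL; apply/allP => c cin; apply/allP => x; apply: canon_lt cL cin.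
Qed.

Definition lah_weight (L : seq (seq nat)) : nat := Defs.inv (lah_list_word L).

(** [A] holds the blocks already passed. The Lah word reverses the blocks, so [A] stands to the
    right of the new letter, and all its letters and separators are inverted with it: this is the
    middle factor. A block of l letters has l + 1 places, as many as its letters and its
    separator. *)
Lemma lah_weight_insb N A L : all (all (ltn^~ N)) (A ++ L) ->
  \sum_(M <- insb N L) 'X^(lah_weight (A ++ M)) =
    'X^(lah_weight (A ++ L)) * 'X^(size (flatten A) + size A) *
    qnum (size (flatten L) + size L).
Proof.
elim: L A => [|c L IH] A hA; first by rewrite big_nil /qnum big_ord0 mulr0.
rewrite big_insb_cons.
(* The block [c] joins the prefix, so that the induction hypothesis covers the insertions further
   on. *)
under [X in _ + X]eq_bigr => M _ do rewrite -cat_rcons.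
rewrite IH ?cat_rcons // flatten_rcons size_rcons size_cat.
rewrite (eq_big_seq (fun i => 'X^(lah_weight (A ++ c :: L)) *
  'X^(size (flatten A) + size A) * 'X^(0 + (size c).+1 - i.+1))) => [|i].
  rewrite -mulr_sumr sumXn_iota /= size_cat.
  have -> : (size c + size (flatten L) + (size L).+1 =
             (size c).+1 + (size (flatten L) + size L))%N by lia.
  rewrite (qnumD (size c).+1) mulrDr; congr (_ + _); rewrite mulrA;
    congr (_ * _).
  by rewrite -!exprD; congr 'X^_; lia.
rewrite mem_iota => hi; rewrite -!exprD; congr 'X^_.
move: hA; rewrite all_cat /= => /and3P[hA hc hL].
rewrite /lah_weight !lah_list_word_cat -[in RHS](cat_take_drop i c).
rewrite !map_cat /=; set t := map _ (take i c); set d := map _ (drop i c).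
(* Regrouping puts the shifted letter [N.+1] between a prefix and a suffix, as [inv_insert]
   requires. *)
rewrite -!catA /= -(cat_cons 0%N t) -(cat_cons 0%N t (d ++ _)).
rewrite !(catA _ (0%N :: t)) inv_insert.
  by rewrite cat_take_drop size_cat size_map size_drop size_lah_list_word; lia.
rewrite !all_cat !all_lah_list_word //= andbT -all_cat -map_cat.
by rewrite cat_take_drop all_map.
Qed.

(** The new block comes first in the Lah word, so its letter is inverted with all N letters and all
    [size L] separators that follow. *)
Lemma lah_weight_rcons N L : canon N L ->
  lah_weight (rcons L [:: N]) = (lah_weight L + (N + size L))%N.
Proof.
move=> cL; rewrite /lah_weight /lah_list_word rev_rcons /= inv0s.
rewrite (@inv_insert N.+1 [::]) ?size_lah_list_word ?(canon_size cL) //=.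
exact/all_lah_list_word/canon_all.
Qed.

(** * Inversions of words of cycles *)

Definition cycle_head_min (c : seq nat) : bool := all (leq (head 0%N c)) c.

(** Here [A] stands to the left of N and gives no inversion with it. A cycle of l letters has l
    admissible places, all but the front, and N is inverted with every letter of the later
    cycles. *)
Lemma cycle_weight_insb N A L :
    all (all (ltn^~ N)) (A ++ L) -> [::] \notin L -> all cycle_head_min L ->
  \sum_(M <- insb N L | all cycle_head_min M) 'X^(Defs.inv (flatten (A ++ M))) =
    'X^(Defs.inv (flatten (A ++ L))) * qnum (size (flatten L)).
Proof.
elim: L A => [|c L IH] A hA L0 hL;
  first by rewrite big_nil /qnum big_ord0 mulr0.
case: c hA L0 hL => [|x c hA]; first by rewrite inE.
rewrite inE negb_or /= => L0 /andP[hc hL].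
rewrite big_insb_cons.
rewrite [X in _ + X](eq_bigl (all cycle_head_min)) => [|M];
  last by rewrite /= hc.
under [X in _ + X]eq_bigr => M _ do rewrite -cat_rcons.
rewrite IH ?cat_rcons //.
have [xN cN] : (x < N)%N /\ all (ltn^~ N) c.
  by move: hA; rewrite all_cat /= => /and3P[_ /andP[]].
(* At the front N would precede a smaller letter of its cycle. *)
have hN : all cycle_head_min
            ((take 0 (x :: c) ++ N :: drop 0 (x :: c)) :: L) = false.
  by rewrite /= /cycle_head_min /= [(N <= x)%N]leqNgt xN andbF.
rewrite -[iota 0 _]/(0%N :: iota 1 (size (x :: c))) big_cons hN.
rewrite big_mkcond (eq_big_seq (fun i =>
  'X^(Defs.inv (flatten (A ++ (x :: c) :: L))) *
  'X^(size (flatten L)) * 'X^(1 + size (x :: c) - i.+1))) => [|[|i]].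
- rewrite -mulr_sumr sumXn_iota size_cat /= -[(_ + size (flatten L)).+1]addSn.
  by rewrite addnC qnumD mulrDr mulrA addrC.
- by rewrite mem_iota.
rewrite mem_iota => hi /=; rewrite hL andbT.
have -> : cycle_head_min (x :: take i c ++ N :: drop i c).
  move: hc; rewrite /cycle_head_min /= leqnn all_cat /= (ltnW xN) /=.
  by rewrite -{1}(cat_take_drop i c) all_cat.
rewrite -!exprD; congr 'X^_; rewrite !flatten_cat /= -catA /=.
rewrite -(cat_cons x (take i c)) catA inv_insert; last first.
  rewrite -!catA /= (catA (take i c)) cat_take_drop -cat_cons.
  rewrite -[(x :: c) ++ _]/(flatten ((x :: c) :: L)) -flatten_cat.
  apply/allP => y /flattenP[d dA yd].
  exact: (allP (allP hA d dA)).
rewrite size_cat size_drop -!catA /= (catA (take i c)) cat_take_drop.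
by move: hi => /=; lia.
Qed.

(** * The weight of a partition *)

Fixpoint part_weight_from (j : nat) (L : seq (seq nat)) : nat :=
  if L is c :: L' then (j * size c + part_weight_from j.+1 L')%N else 0%N.

(** An increasing word can only take N at its end, so each block offers one place and adds its own
    index to the weight. *)
Lemma part_weight_insb N j L :
    all (all (ltn^~ N)) L -> [::] \notin L -> all (sorted ltn) L ->
  \sum_(M <- insb N L | all (sorted ltn) M) 'X^(part_weight_from j M) =
    'X^(part_weight_from j L) * 'X^j * qnum (size L).
Proof.
elim: L j => [|c L IH] j; first by rewrite big_nil /qnum big_ord0 mulr0.
rewrite inE negb_or eq_sym /= => /andP[hc hL] /andP[c0 L0] /andP[sc sL].
have ec : iota 0 (size c).+1 = iota 0 (size c) ++ [:: size c].
  by rewrite -addn1 iotaD.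
rewrite big_insb_cons ec /= sc /=.
under [X in _ + X]eq_bigr => M _ do rewrite exprD.
rewrite -mulr_sumr IH // big_cat /= big_seq_cond big_pred0 => [|i].
  rewrite add0r [X in X + _]big_mkcond big_seq1 take_size drop_size sL andbT
    cats1.
  have -> : sorted ltn (rcons c N).
    case: c hc sc {c0 ec} => //= x c hc sc; rewrite rcons_path sc /=.
    by have /allP/(_ _ (mem_last x c)) : all (ltn^~ N) (x :: c) := hc.
  rewrite size_rcons mulnS -[(size L).+1]add1n qnumD [qnum 1](_ : _ = 1).
    by rewrite !exprD expr1 exprS; ring.
  by rewrite /qnum big_ord1.
(* At any place but the last, the letter following N is smaller than N. *)
rewrite mem_iota; apply/negbTE/negP => /andP[hi /andP[]].
rewrite sorted_cat_cons (drop_nth 0%N) /=; last by lia.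
case/andP=> _ /andP[+ _] _.
have := all_nthP 0%N hc i; lia.
Qed.

Lemma part_weight_from_rcons N j L :
  part_weight_from j (rcons L [:: N]) = (part_weight_from j L + (j + size L))%N.
Proof.
elim: L j => [|c L IH] j /=; first by lia.
by rewrite IH; lia.
Qed.

(** * The hypotheses of the recurrence for the three statistics *)

Lemma sorted_delete N c1 c2 : c1 ++ c2 != [::] -> all (ltn^~ N) (c1 ++ c2) ->
  sorted ltn (c1 ++ N :: c2) -> sorted ltn (c1 ++ c2).
Proof.
move=> _ _; rewrite !(sorted_pairwise ltn_trans) !pairwise_cat allrel_consr.
by rewrite pairwise_cons => /and3P[/andP[_ ->] -> /andP[_ ->]].
Qed.

Lemma part_rcons N L : canon N L ->
  part_weight_from 0 (rcons L [:: N]) = (part_weight_from 0 L + size L)%N.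
Proof. by rewrite part_weight_from_rcons add0n. Qed.

Lemma part_insb N L : canon N L -> all (sorted ltn) L ->
  \sum_(M <- insb N L | all (sorted ltn) M) 'X^(part_weight_from 0 M) =
    'X^(part_weight_from 0 L) * qnum (size L).
Proof.
move=> cL sL; have /and3P[_ _ L0] := cL.
by rewrite part_weight_insb ?(canon_all cL) // expr0 mulr1.
Qed.

Lemma lah_insb N L : canon N L -> all predT L ->
  \sum_(M <- insb N L | all predT M) 'X^(lah_weight M) =
    'X^(lah_weight L) * qnum (N + size L).
Proof.
move=> cL _; rewrite (eq_bigl predT) => [|M]; last exact/allP.
by rewrite (@lah_weight_insb N [::]) ?canon_all // mulr1 (canon_size cL).
Qed.

Lemma cycle_head_min1 N : cycle_head_min [:: N].
Proof. by rewrite /cycle_head_min /= leqnn. Qed.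

Lemma cycle_head_min_delete N c1 c2 :
  c1 ++ c2 != [::] -> all (ltn^~ N) (c1 ++ c2) ->
  cycle_head_min (c1 ++ N :: c2) -> cycle_head_min (c1 ++ c2).
Proof.
case: c1 => [|x c1] /=; last first.
  by rewrite /cycle_head_min /= !all_cat /= => _ _ /and4P[-> -> _ ->].
case: c2 => // y c2 _ /= /andP[yN _]; rewrite /cycle_head_min /=.
by rewrite [(N <= y)%N]leqNgt yN andbF.
Qed.

(** A largest letter in last position creates no inversion; [+ 0] matches the form of [w_rcons]. *)
Lemma cycle_rcons N L : canon N L ->
  Defs.inv (flatten (rcons L [:: N])) = (Defs.inv (flatten L) + 0)%N.
Proof.
move=> cL; rewrite flatten_rcons inv_insert cats0 //.
by apply/allP => x; rewrite (canon_mem _ cL).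
Qed.

Lemma cycle_insb N L : canon N L -> all cycle_head_min L ->
  \sum_(M <- insb N L | all cycle_head_min M) 'X^(Defs.inv (flatten M)) =
    'X^(Defs.inv (flatten L)) * qnum N.
Proof.
move=> cL hL; have /and3P[_ _ L0] := cL.
by rewrite (@cycle_weight_insb N [::]) ?canon_all // (canon_size cL).
Qed.

(** * Encoding the combinatorial structures *)

Definition letter_set (N : nat) (c : seq nat) : {set 'I_N} :=
  [set x | val x \in c].

Lemma uniq_flatten_pairwise (T : eqType) (L : seq (seq T)) :
  all uniq L -> pairwise (fun c d => ~~ has (mem c) d) L -> uniq (flatten L).
Proof.
elim: L => //= c L IH /andP[uc uL] /andP[/allP cL pL].
rewrite cat_uniq uc IH // andbT /=.
by apply/hasPn => x /flattenP[d /cL /hasPn]; apply.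
Qed.

Lemma canon_disjoint N L c d x : canon N L -> c \in L -> d \in L ->
  x \in c -> x \in d -> c = d.
Proof.
move=> /canon_uniq uL cinL dinL xc xd; apply/eqP; apply: contraTT isT => ncd.
case/splitPr: cinL dinL uL => L1 L2; rewrite flatten_cat mem_cat inE eq_sym.
rewrite (negbTE ncd) /= !cat_uniq; case/orP=> dL.
  case/and3P=> _ /hasP[]; exists x; first by rewrite mem_cat xc.
  by apply/flattenP; exists d.
case/and5P=> _ _ _ /hasP[] //; exists x => //.
by apply/flattenP; exists d.
Qed.

(** * Lists of words whose letter sets are the blocks of a partition *)

Section Blocks.

Variables (N : nat) (P : {set {set 'I_N}}) (L : seq (seq nat)).
Hypothesis partP : partition P [set: 'I_N].
Hypothesis PL : P =i [seq letter_set N c | c <- L].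

Let tiP : trivIset P. Proof. by case/and3P: partP. Qed.

Let mem_letter_set c : c \in L -> letter_set N c \in P.
Proof. by move=> cL; rewrite PL map_f. Qed.

Lemma ord_block (x : 'I_N) : exists2 c, c \in L & val x \in c.
Proof.
have : x \in cover P by rewrite (cover_partition partP) inE.
case/bigcupP=> B; rewrite PL => /mapP[c cL ->]; rewrite inE => xc.
by exists c.
Qed.

Lemma pblock_letter_set c (x : 'I_N) : c \in L -> val x \in c ->
  pblock P x = letter_set N c.
Proof.
by move=> cL xc; apply: def_pblock => //; rewrite ?mem_letter_set ?inE.
Qed.

Lemma canon_partition : all (all (ltn^~ N)) L -> all uniq L ->
  pairwise min_lt L -> canon N L.
Proof.
move=> /allP LN uL pL; have sub c x : c \in L -> x \in c -> (x < N)%N.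
  by move=> /LN/allP; apply.
apply/and3P; split => //; last first.
  apply/negP => /mem_letter_set; rewrite (_ : letter_set _ _ = set0).
    by case/and3P: partP => _ _ /negP.
  by apply/setP => x; rewrite !inE.
apply: uniq_perm; rewrite ?iota_uniq //.
  apply: uniq_flatten_pairwise => //.
  apply: (sub_in_pairwise (P := mem L)) pL; last exact/allP.
  move=> c d cL dL ltcd; apply/negP => /hasP[x xd xc].
  pose x' := Ordinal (sub _ _ cL xc).
  (* Words with a common letter lie over the same block, so the witness of [min_lt c d] also lies in
     [d] and would be less than itself. *)
  have /setP ecd : letter_set N c = letter_set N d.
    by rewrite -(@pblock_letter_set c x') // (@pblock_letter_set d x').
  have /hasP[y yc /allP yd] := ltcd.
  have := ecd (Ordinal (sub _ _ cL yc)); rewrite !inE /= yc => /esym/yd.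
  by rewrite /= ltnn.
move=> x; rewrite mem_iota add0n; apply/flattenP/idP => [[c cL xc]|xN].
  exact: sub cL xc.
by have [c] := ord_block (Ordinal xN); exists c.
Qed.

Hypothesis cL : canon N L.

Lemma letter_set_inj : {in L &, injective (letter_set N)}.
Proof.
move=> c d cinL dinL ecd.
case: c cinL ecd => [/(canon_block cL)//|x c] cinL /setP ecd.
apply: (canon_disjoint cL cinL dinL (mem_head _ _)).
have := ecd (Ordinal (canon_lt cL cinL (mem_head _ _))).
by rewrite !inE /= eqxx => <-.
Qed.

Lemma card_canon : #|P| = size L.
Proof.
rewrite (eq_card PL) -(size_map (letter_set N)); apply/card_uniqP.
rewrite (map_inj_in_uniq letter_set_inj); apply: pairwise_uniq min_lt_irr _.
by case/and3P: cL.
Qed.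

Lemma distinct_blocks_canon s : distinct_blocks s P = all (separated s) L.
Proof.
apply/'forall_forallP/allP => [h c cinL|h x y].
  apply/allrelP => x y xc yc; apply/implyP => /andP[xs ys].
  pose x' := Ordinal (canon_lt cL cinL xc).
  pose y' := Ordinal (canon_lt cL cinL yc).
  apply: contraTT isT => nxy.
  have := h x' y';
    rewrite /= xs ys (@pblock_letter_set c x') ?(@pblock_letter_set c y') //.
  by rewrite eqxx -val_eqE /= nxy.
apply/implyP => /and3P[xs ys nxy]; have [c cinL xc] := ord_block x.
rewrite (pblock_letter_set cinL xc); apply: contraNneq nxy => ec.
have yc : val y \in c.
  suff: y \in letter_set N c by rewrite inE.
  by rewrite ec mem_pblock (cover_partition partP) inE.
have /allrelP/(_ _ _ xc yc) := h c cinL.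
by rewrite xs ys.
Qed.

End Blocks.

Lemma partition_canon N L : canon N L ->
  partition [set:: [seq letter_set N c | c <- L]] [set: 'I_N].
Proof.
move=> cL; apply/and3P; split.
- rewrite eqEsubset subsetT /=; apply/subsetP => x _.
  have : val x \in flatten L by rewrite (canon_mem _ cL); apply: ltn_ord.
  case/flattenP=> c cinL xc; apply/bigcupP; exists (letter_set N c);
    rewrite ?inE //.
  by rewrite map_f.
- apply/trivIsetP => A B; rewrite !inE => /mapP[c cinL ->] /mapP[d dinL ->] ne.
  apply/pred0P => x /=; apply/negP; rewrite !inE => /andP[xc xd].
  by rewrite (canon_disjoint cL cinL dinL xc xd) eqxx in ne.
- apply/negP; rewrite inE => /mapP[c cinL /setP e0].
  have := canon_block cL cinL; case: c cinL e0 => // x c cinL e0 _.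
  have := e0 (Ordinal (canon_lt cL cinL (mem_head _ _))).
  by rewrite !inE eqxx.
Qed.

(** Reindexing along [e], a bijection from the structures [Q] onto the canonical lists of words in
    [C]; since [gen] has no repetitions, its entries can be permuted into the image of [e]. [R]
    carries the number of blocks and the separation of the first s elements. *)
Lemma sum_csum (T : finType) (Q R : pred T) (e : T -> seq (seq nat))
    (C : pred (seq nat)) (w : seq (seq nat) -> nat) (v : T -> nat)
    (s N K : nat) :
    (forall t, Q t -> canon N (e t) && all C (e t)) ->
    {in Q &, injective e} ->
    (forall L, canon N L -> all C L -> exists2 t, Q t & e t = L) ->
    (forall t, Q t -> v t = w (e t)) ->
    (forall t, Q t -> R t = (size (e t) == K) && all (separated s) (e t)) ->
  \sum_(t | Q t && R t) 'X^(v t) = csum C w s N K.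
Proof.
move=> eC e_inj e_surj vw RE; rewrite /csum.
rewrite (eq_bigl (fun L => all C L && (all (separated s) L && (size L == K))))
  //.
rewrite -big_filter_cond.
rewrite (perm_big [seq e t | t <- enum Q]) /=; last first.
  apply: uniq_perm; first by rewrite filter_uniq ?gen_uniq.
    rewrite map_inj_in_uniq ?enum_uniq // => x y.
    by rewrite !mem_enum; apply: e_inj.
  move=> L; rewrite mem_filter gen_canon andbC; apply/andP/mapP => [[cL CL]|].
    by have [t Qt <-] := e_surj L cL CL; exists t; rewrite ?mem_enum.
  by case=> t; rewrite mem_enum => /eC/andP[? ?] ->.
rewrite big_map big_enum_cond /=; apply: eq_big => t; last by case/andP=> /vw->.
by have [Qt|nQ] := boolP (Q t);
  rewrite unfold_in /= ?(negbTE nQ) // Qt RE // andbC.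
Qed.

Lemma minb_le N (B : {set 'I_N}) x : x \in B -> (minb B <= x)%N.
Proof.
rewrite /minb; elim: (index_enum _) (mem_index_enum x) => // y r IH.
rewrite inE big_cons => /orP[/eqP<- xB|xr xB]; first by rewrite xB geq_minl.
by case: ifP => _; rewrite ?(leq_trans (geq_minr _ _)) ?IH.
Qed.

Lemma minb_mem N (B : {set 'I_N}) : B != set0 ->
  exists2 x : 'I_N, x \in B & minb B = x.
Proof.
case/set0Pn=> y yB.
(* The only value not attained in [B] is the default N, which exceeds every element. *)
have [h|//] : minb B = N \/ exists2 x : 'I_N, x \in B & minb B = x.
  rewrite /minb; elim/big_ind: _ => [|m n hm hn|x xB]; [by left| |].
    by rewrite /minn; case: ifP.
  by right; exists x.
by have := minb_le yB; rewrite h leqNgt ltn_ord.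
Qed.

(** Links the weak order that sorts [blocks] and [lah_words] to [min_lt]; disjointness makes the
    inequality strict. *)
Lemma minb_min_lt N (B D : {set 'I_N}) (c d : seq nat) :
    B != set0 -> [disjoint B & D] -> (minb B <= minb D)%N ->
    (forall x : 'I_N, x \in B -> val x \in c) ->
    (forall y, y \in d -> exists2 x : 'I_N, x \in D & y = val x) ->
  min_lt c d.
Proof.
move=> /minb_mem[x xB mB] dBD leBD Bc dD.
apply/hasP; exists (val x); first exact: Bc.
apply/allP => _ /dD[y yD ->] /=; rewrite ltn_neqAle; apply/andP; split.
  by apply: contraTneq xB => /val_inj->; rewrite (disjointFl dBD).
by rewrite -mB (leq_trans leBD) // minb_le.
Qed.

(** * Set partitions as lists of increasing words *)

Definition enc_set N (B : {set 'I_N}) : seq nat := [seq val x | x <- enum B].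

Definition enc_part N (P : {set {set 'I_N}}) : seq (seq nat) :=
  [seq enc_set B | B <- blocks P].

Lemma mem_enc_set N (B : {set 'I_N}) (x : 'I_N) :
  (val x \in enc_set B) = (x \in B).
Proof. by rewrite mem_map ?mem_enum //; apply: val_inj. Qed.

Lemma enc_setP N (B : {set 'I_N}) y :
  y \in enc_set B -> exists2 x : 'I_N, x \in B & y = val x.
Proof. by case/mapP=> x; rewrite mem_enum; exists x. Qed.

Lemma enc_setK N : cancel (@enc_set N) (letter_set N).
Proof. by move=> B; apply/setP => x; rewrite inE mem_enc_set. Qed.

Lemma enc_set_sorted N (B : {set 'I_N}) : sorted ltn (enc_set B).
Proof.
rewrite /enc_set {1}/enum_mem sorted_map; apply: sorted_filter.
  by move=> y x z; apply: ltn_trans.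
rewrite -enumT -[sorted _ _]sorted_map val_enum_ord.
exact: iota_ltn_sorted.
Qed.

Lemma letter_setK N c : all (ltn^~ N) c -> sorted ltn c ->
  enc_set (letter_set N c) = c.
Proof.
move=> /allP cN sc; apply: (irr_sorted_eq ltn_trans ltnn) => //.
  exact: enc_set_sorted.
move=> y; apply/idP/idP => [/enc_setP[x] + ->|yc]; first by rewrite inE.
by rewrite -[y]/(val (Ordinal (cN y yc))) mem_enc_set inE.
Qed.

Lemma mem_blocks N (P : {set {set 'I_N}}) : blocks P =i P.
Proof. by move=> B; rewrite mem_sort mem_enum. Qed.

Lemma mem_enc_part N (P : {set {set 'I_N}}) :
  P =i [seq letter_set N c | c <- enc_part P].
Proof.
move=> B; rewrite -map_comp (eq_map (g := id)) ?map_id ?mem_blocks //.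
exact: enc_setK.
Qed.

Lemma enc_part_canon N (P : {set {set 'I_N}}) : partition P [set: 'I_N] ->
  canon N (enc_part P).
Proof.
move=> partP; apply: (canon_partition partP (mem_enc_part P)).
- apply/allP => _ /mapP[B _ ->]; apply/allP => _ /enc_setP[x _ ->] /=.
  exact: ltn_ord.
- apply/allP => _ /mapP[B _ ->]; apply: (sorted_uniq ltn_trans ltnn).
  exact: enc_set_sorted.
have /and3P[_ /trivIsetP tiP nP] := partP.
(* Sorting only gives a weak inequality; distinctness is added so that disjointness of the blocks
   can make it strict. *)
have : pairwise [rel B D | (minb B <= minb D)%N && (B != D)] (blocks P).
  rewrite pairwise_relI -uniq_pairwise sort_uniq enum_uniq andbT.
  rewrite -sorted_pairwise; last by move=> y x z; apply: leq_trans.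
  by apply: sort_sorted => B D; apply: leq_total.
rewrite pairwise_map; apply: (sub_in_pairwise (P := mem P)).
  move=> B D BP DP /andP[leBD nBD]; apply: (@minb_min_lt _ B D) => //.
  - by apply: contraNneq nP => <-.
  - exact: tiP.
  - by move=> x; rewrite mem_enc_set.
  - exact: enc_setP.
by apply/allP => B; rewrite mem_blocks.
Qed.

(** A strict order leaves one arrangement of a given set of words. *)
Lemma canon_eq N L M : canon N L -> canon N M -> L =i M -> L = M.
Proof.
case/and3P=> _ pL _ /and3P[_ pM _].
by apply: (irr_sorted_eq min_lt_trans min_lt_irr); apply: pairwise_sorted.
Qed.

Lemma part_weight_fromE j L :
  part_weight_from j L = (\sum_(i < size L) (j + i) * size (nth [::] L i))%N.
Proof.
elim: L j => [|c L IH] j; first by rewrite big_ord0.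
rewrite big_ord_recl /= addn0 IH; congr addn.
by apply: eq_bigr => i _; rewrite /bump /= add1n addSnnS.
Qed.

Lemma Sq_csum s n k :
  Sq s n k = csum (sorted ltn) (part_weight_from 0) s (n + s) (k + s).
Proof.
apply: (sum_csum (e := @enc_part (n + s))).
- move=> P partP; rewrite enc_part_canon //=.
  by apply/allP => _ /mapP[B _ ->]; apply: enc_set_sorted.
- move=> P P' _ _ eP; apply/setP => B.
  by rewrite mem_enc_part eP -mem_enc_part.
- move=> L cL /allP sL; pose P := [set:: [seq letter_set (n + s) c | c <- L]].
  have PL : P =i [seq letter_set (n + s) c | c <- L] by move=> B; rewrite inE.
  have partP := partition_canon cL.
  exists P => //; apply: (canon_eq (enc_part_canon partP) cL) => c.
  have encK d : d \in L -> enc_set (letter_set (n + s) d) = d.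
    by move=> dL; rewrite letter_setK ?sL //; apply: (allP (canon_all cL)).
  apply/mapP/idP => [[B]|cinL].
    by rewrite mem_blocks PL => /mapP[d dL ->] ->; rewrite encK.
  by exists (letter_set (n + s) c); rewrite ?encK // mem_blocks PL map_f.
- move=> P _; rewrite part_weight_fromE /wpart size_map.
  apply: eq_bigr => i _; rewrite add0n (nth_map set0) //.
  by rewrite size_map -cardE.
move=> P partP; have cP := enc_part_canon partP.
rewrite (card_canon (mem_enc_part P) cP).
by rewrite (distinct_blocks_canon partP (mem_enc_part P) cP).
Qed.

(** * Lah distributions as lists of words *)

Definition enc_word N (W : N.-bseq 'I_N) : seq nat := [seq val x | x <- val W].

(** [lah_words] goes by decreasing minima, and [canon] wants increasing ones. *)
Definition enc_lah N (D : {set N.-bseq 'I_N}) : seq (seq nat) :=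
  rev [seq enc_word W | W <- lah_words D].

Lemma enc_word_inj N : injective (@enc_word N).
Proof. by move=> V W /(inj_map val_inj)/val_inj. Qed.

Lemma letter_set_enc_word N (W : N.-bseq 'I_N) :
  letter_set N (enc_word W) = supp W.
Proof. by apply/setP => x; rewrite !inE mem_map //; apply: val_inj. Qed.

Lemma mem_enc_lah N (D : {set N.-bseq 'I_N}) c :
  (c \in enc_lah D) = (c \in [seq enc_word W | W in D]).
Proof.
rewrite mem_rev; apply/mapP/mapP => -[W WD ->]; exists W => //;
by move: WD; rewrite mem_sort mem_enum.
Qed.

Lemma underlying_enc N (D : {set N.-bseq 'I_N}) :
  underlying D =i [seq letter_set N c | c <- enc_lah D].
Proof.
move=> B; apply/imsetP/mapP => [[W WD ->]|[c]].
  by exists (enc_word W);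
    rewrite ?letter_set_enc_word // mem_enc_lah map_f ?mem_enum.
rewrite mem_enc_lah => /mapP[W]; rewrite mem_enum => WD -> ->.
by exists W; rewrite ?letter_set_enc_word.
Qed.

Lemma enc_lah_canon N (D : {set N.-bseq 'I_N}) :
  is_lah D -> canon N (enc_lah D).
Proof.
case/and3P=> partD /forall_inP uD /forall_inP iD.
apply: (canon_partition partD (underlying_enc D)).
- apply/allP => c; rewrite mem_enc_lah => /mapP[W _ ->].
  by apply/allP => _ /mapP[x _ ->]; apply: ltn_ord.
- apply/allP => c; rewrite mem_enc_lah => /mapP[W]; rewrite mem_enum => WD ->.
  by rewrite map_inj_uniq ?uD //; apply: val_inj.
have /and3P[_ /trivIsetP tiP nP] := partD.
have : pairwise [rel V W | (minb (supp W) <= minb (supp V))%N && (V != W)]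
         (lah_words D).
  rewrite pairwise_relI -uniq_pairwise sort_uniq enum_uniq andbT.
  rewrite -sorted_pairwise; last by move=> y x z h1 h2; apply: leq_trans h2 h1.
  by apply: sort_sorted => V W; apply: leq_total.
move=> pD; rewrite -sorted_pairwise; last exact: min_lt_trans.
rewrite rev_sorted; apply: pairwise_sorted; rewrite pairwise_map.
apply: (sub_in_pairwise (P := mem D)) pD; last first.
  by apply/allP => V; rewrite mem_sort mem_enum.
move=> V W VD WD /andP[leVW nVW].
have VP : supp V \in underlying D by apply: imset_f.
have WP : supp W \in underlying D by apply: imset_f.
apply: (@minb_min_lt _ (supp W) (supp V)) => //.
- by apply: contraNneq nP => <-.
(* Distinct words have distinct supports by the last clause of [is_lah], hence disjoint ones. *)
- apply: tiP => //; apply: contraNneq nVW => eWV.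
  have /forall_inP/(_ _ WD)/implyP h := iD V VD.
  by apply: h; rewrite eWV.
- by move=> x; rewrite -letter_set_enc_word inE.
- by move=> _ /mapP[x xV ->]; exists x; rewrite // inE.
Qed.

Lemma size_enc_lah N (D : {set N.-bseq 'I_N}) : size (enc_lah D) = #|D|.
Proof. by rewrite size_rev size_map size_sort -cardE. Qed.

Lemma lah_weight_enc N (D : {set N.-bseq 'I_N}) :
  Defs.inv (lah_word D) = lah_weight (enc_lah D).
Proof.
rewrite /lah_weight /lah_list_word /enc_lah revK -map_comp /lah_word.
rewrite (eq_map (g := fun W : N.-bseq 'I_N =>
  0%N :: [seq (val x).+1 | x <- val W])).
  by case: (lah_words D) => [//|W s] /=; rewrite inv0s.
by move=> W /=; rewrite /enc_word -map_comp.
Qed.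

Lemma map_val_insub N c : all (ltn^~ N) c ->
  [seq val x | x <- pmap (insub : nat -> option 'I_N) c] = c.
Proof.
move=> /allP cN; rewrite (pmap_filter (insubK _)).
by apply/all_filterP/allP => x /cN /= xN; rewrite insubT.
Qed.

Lemma Lq_csum s n k : Lq s n k = csum predT lah_weight s (n + s) (k + s).
Proof.
apply: (sum_csum (e := @enc_lah (n + s))).
- by move=> D lD; rewrite enc_lah_canon //=; apply/allP.
- move=> D D' _ _ eD; apply/setP => W.
  have memD (E : {set (n + s).-bseq 'I_(n + s)}) :
      (W \in E) = (enc_word W \in enc_lah E).
    rewrite mem_enc_lah (mem_map (@enc_word_inj _)) mem_enum //.
  by rewrite memD eD -memD.
- move=> L cL _;
  pose D := [set W : (n + s).-bseq 'I_(n + s) | enc_word W \in L].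
  have word c : c \in L -> exists W : (n + s).-bseq 'I_(n + s), enc_word W = c.
    move=> cinL; have cN := allP (canon_all cL) c cinL.
    (* The length bound of a bounded sequence holds because [c] is part of [flatten L], which has n
       + s letters. *)
    have sz : (size (pmap (insub : nat -> option 'I_(n + s)) c) <= n + s)%N.
      rewrite -(size_map val) map_val_insub // -(canon_size cL).
      case/splitPr: cinL => L1 L2.
      by rewrite flatten_cat size_cat /= size_cat; lia.
    by exists (Bseq sz); apply: map_val_insub.
  have memD c : (c \in L) = (c \in [seq enc_word W | W in D]).
    apply/idP/mapP => [cinL|[W]]; last by rewrite mem_enum inE => ? ->.
    have [W eW] := word c cinL.
    by exists W; rewrite // mem_enum inE eW.
  have eD : enc_lah D =i L by move=> c; rewrite mem_enc_lah memD.
  have uD : underlying D = [set:: [seq letter_set (n + s) c | c <- L]].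
    apply/setP => B; rewrite underlying_enc inE.
    by apply: eq_mem_map.
  have lD : is_lah D.
    apply/and3P; split; first by rewrite uD partition_canon.
      apply/forall_inP => W; rewrite inE => /(canon_block_uniq cL).
      exact: map_uniq.
    apply/forall_inP => V; rewrite inE => VL; apply/forall_inP => W.
    rewrite inE => WL; apply/implyP; rewrite -!letter_set_enc_word => /eqP eVW.
    by apply/eqP/enc_word_inj/(letter_set_inj cL).
  by exists D => //; apply: canon_eq (enc_lah_canon lD) cL eD.
- by move=> D _; apply: lah_weight_enc.
move=> D lD; have [partD _ _] := and3P lD.
rewrite (distinct_blocks_canon partD (underlying_enc D) (enc_lah_canon lD)).
by rewrite size_enc_lah.
Qed.

(** * Permutations as lists of cycles in standard form *)

Definition enc_perm N (p : {perm 'I_N}) : seq (seq nat) :=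
  [seq [seq val y | y <- traject p x #|porbit p x|] | x <- cycle_minima p].

Lemma partition_porbits (T : finType) (p : {perm T}) :
  partition (porbits p) [set: T].
Proof.
apply/and3P; split.
- rewrite eqEsubset subsetT; apply/subsetP => x _; apply/bigcupP.
  by exists (porbit p x); rewrite ?imset_f ?porbit_id.
- apply/trivIsetP => _ _ /imsetP[x _ ->] /imsetP[y _ ->] ne.
  apply/pred0P => z /=; apply: contraNF ne => /andP[zx zy].
  rewrite -eq_porbit_mem in zx; rewrite -eq_porbit_mem in zy.
  by rewrite -(eqP zx) -(eqP zy).
- by apply/imsetP => -[x _ /setP/(_ x)]; rewrite porbit_id inE.
Qed.

Lemma letter_set_traject N (p : {perm 'I_N}) x :
  letter_set N [seq val y | y <- traject p x #|porbit p x|] = porbit p x.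
Proof.
apply/setP => y; rewrite inE mem_map; last exact: val_inj.
by rewrite -porbit_traject.
Qed.

Lemma cycle_minimaP N (p : {perm 'I_N}) (x : 'I_N) :
  reflect (forall y, y \in porbit p x -> (x <= y)%N) (x \in cycle_minima p).
Proof. by rewrite mem_filter mem_enum andbT; apply: (iffP forall_inP). Qed.

Lemma porbits_enc N (p : {perm 'I_N}) :
  porbits p =i [seq letter_set N c | c <- enc_perm p].
Proof.
move=> B; apply/imsetP/mapP => [[x _ ->]|[_ /mapP[x xp ->] ->]]; last first.
  by exists x; rewrite // letter_set_traject.
have [|y yx my] := @minb_mem _ (porbit p x).
  by apply/set0Pn; exists x; apply: porbit_id.
have exy : porbit p y = porbit p x by apply/eqP; rewrite eq_porbit_mem.
exists [seq val z | z <- traject p y #|porbit p y|]; last first.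
  by rewrite letter_set_traject exy.
apply: (map_f (fun y => [seq val z | z <- traject p y #|porbit p y|])).
by apply/cycle_minimaP => z; rewrite exy -my; apply: minb_le.
Qed.

Lemma enc_perm_canon N (p : {perm 'I_N}) : canon N (enc_perm p).
Proof.
apply: (canon_partition (partition_porbits p) (porbits_enc p)).
- apply/allP => _ /mapP[x _ ->]; apply/allP => _ /mapP[y _ ->].
  exact: ltn_ord.
- apply/allP => _ /mapP[x _ ->].
  by rewrite map_inj_uniq ?uniq_traject_porbit //; apply: val_inj.
have : pairwise (relpre val ltn) (cycle_minima p).
  rewrite -sorted_pairwise; last by move=> y x z; apply: ltn_trans.
  apply: sorted_filter; first by move=> y x z; apply: ltn_trans.
  by rewrite -[sorted _ _]sorted_map val_enum_ord; apply: iota_ltn_sorted.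
rewrite pairwise_map; apply: (sub_in_pairwise (P := mem (cycle_minima p))).
  move=> x y _ /cycle_minimaP ym /= ltxy.
  apply/hasP; exists (val x).
    by apply: map_f; rewrite -porbit_traject porbit_id.
  apply/allP => _ /mapP[z + ->]; rewrite -porbit_traject => /ym.
  exact: leq_trans.
exact/allP.
Qed.

Lemma traject_porbit_cons (T : finType) (p : {perm T}) x :
  traject p x #|porbit p x| = x :: traject p (p x) #|porbit p x|.-1.
Proof. by case: #|_| (card_porbit_neq0 p x). Qed.

Lemma enc_perm_head N (p : {perm 'I_N}) : all cycle_head_min (enc_perm p).
Proof.
apply/allP => _ /mapP[x /cycle_minimaP xm ->].
rewrite /cycle_head_min {1}traject_porbit_cons /=.
by apply/allP => _ /mapP[y + ->]; rewrite -porbit_traject => /xm.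
Qed.

Lemma fcycle_traject_porbit (T : finType) (p : {perm T}) x :
  fcycle p (traject p x #|porbit p x|).
Proof.
rewrite traject_porbit_cons /= -[X in rcons _ X](iter_porbit p x).
case: #|_| (card_porbit_neq0 p x) => // m _.
by rewrite iterSr -trajectSr fpath_traject.
Qed.

(** A cycle of [p] through x exhausts the orbit of x; without repetitions, its length is the size of
    the orbit. *)
Lemma traject_porbit_fcycle (T : finType) (p : {perm T}) x c :
  uniq (x :: c) -> fcycle p (x :: c) ->
  traject p x #|porbit p x| = x :: c.
Proof.
move=> uc fc; have ec := fcycle_consE fc.
suff -> : #|porbit p x| = size (x :: c) by rewrite -ec.
have -> : #|porbit p x| = #|x :: c|; last exact/card_uniqP.
apply: eq_card => y; apply/porbitP/idP => [[i ->]|].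
  rewrite permX; elim: i => [|i IH]; first by rewrite mem_head.
  by rewrite iterS; apply: mem_fcycle fc _ IH.
by rewrite ec => /trajectP[i _ ->]; exists i; rewrite permX.
Qed.

(** The image of x under [p] is the cyclic successor of x in the word that contains it. *)
Lemma enc_perm_inj N : injective (@enc_perm N).
Proof.
move=> p p' epp; apply/permP => x.
have [c cp xc] := ord_block (partition_porbits p) (porbits_enc p) x.
have : c \in enc_perm p' by rewrite -epp.
case/mapP: cp xc => y _ -> + /mapP[y' _ /(inj_map val_inj) ec].
rewrite mem_map => [xc|]; last exact: val_inj.
rewrite -(nextE (fcycle_traject_porbit p y) xc).
by rewrite ec -(nextE (fcycle_traject_porbit p' y')) -?ec.
Qed.

(** The permutation sends each x to its cyclic successor in its own word [blk x]. *)
Lemma enc_perm_surj N L : canon N L -> all cycle_head_min L ->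
  exists p : {perm 'I_N}, enc_perm p = L.
Proof.
move=> cL /allP hL.
pose lift c := pmap (insub : nat -> option 'I_N) c.
have mem_lift c (x : 'I_N) : (x \in lift c) = (val x \in c).
  by rewrite mem_pmap_sub.
have liftK c : c \in L -> [seq val x | x <- lift c] = c.
  by move=> cinL; apply/map_val_insub/(allP (canon_all cL)).
have uniq_lift c : c \in L -> uniq (lift c).
  by move=> /(canon_block_uniq cL); apply: pmap_sub_uniq.
pose blk (x : 'I_N) := nth [::] L (find (fun c : seq nat => val x \in c) L).
have blkP x : blk x \in L /\ val x \in blk x.
  have hx : has (fun c : seq nat => val x \in c) L.
    have : val x \in flatten L by rewrite (canon_mem _ cL); apply: ltn_ord.
    by case/flattenP=> c cinL xc; apply/hasP; exists c.
  by split; [rewrite mem_nth -?has_find|exact: (nth_find [::] hx)].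
have blk_eq c (x : 'I_N) : c \in L -> val x \in c -> blk x = c.
  move=> cinL xc; have [bL xb] := blkP x.
  exact: canon_disjoint cL bL cinL xb xc.
pose f x := next (lift (blk x)) x.
have blkf x : blk (f x) = blk x.
  have [bL xb] := blkP x; apply: blk_eq => //.
  by rewrite -mem_lift mem_next mem_lift.
(* [f] stays within a word, where [prev] undoes [next]. *)
have f_inj : injective f.
  move=> x y exy; have exb : blk x = blk y by rewrite -blkf exy blkf.
  have [bL _] := blkP y; move: exy; rewrite /f exb.
  exact: (can_inj (prev_next (uniq_lift _ bL))).
pose p := perm f_inj.
have fcyc c : c \in L -> fcycle p (lift c).
  move=> cinL.
  have ep : {in mem (lift c) &, frel (next (lift c)) =2 frel p}.
    move=> x y xc _ /=; have {}xc : x \in lift c := xc.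
    by rewrite permE /f (blk_eq c) // -mem_lift.
  by rewrite -(eq_in_cycle ep) ?cycle_next ?uniq_lift //; apply/allP.
have trj c : c \in L -> exists x : 'I_N, [/\ val x = head 0%N c, val x \in c &
    [seq val y | y <- traject p x #|porbit p x|] = c].
  move=> cinL; have := liftK c cinL; have := uniq_lift c cinL.
  have := fcyc c cinL; case: (lift c) => [_ _ /esym ec|x l fl ul ec].
    by have := canon_block cL cinL; rewrite ec.
  exists x; split; rewrite -?ec ?mem_head //.
  by rewrite (traject_porbit_fcycle ul fl).
exists p; apply: (canon_eq (enc_perm_canon p) cL) => c.
apply/mapP/idP => [[x /cycle_minimaP xm ->]|cinL].
  have [bL xb] := blkP x; have [y [yh yb ey]] := trj _ bL.
  have /eqP exy : porbit p x == porbit p y.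
    by rewrite eq_porbit_mem -letter_set_traject ey inE.
  (* Both are the least element of the same orbit: x as a cycle minimum, y as the head of its
     word. *)
  suff -> : x = y by rewrite ey.
  apply/val_inj/anti_leq/andP; split.
    by apply: xm; rewrite exy porbit_id.
  by rewrite /= -[nat_of_ord y]/(val y) yh; apply: (allP (hL _ bL)).
have [x [xh xc ex]] := trj c cinL; exists x => //.
apply/cycle_minimaP => y; rewrite -letter_set_traject ex inE => yc.
by rewrite -[nat_of_ord x]/(val x) xh; apply: (allP (hL _ cinL)).
Qed.

Lemma cq_csum s n k :
  cq s n k =
    csum cycle_head_min (fun L => Defs.inv (flatten L)) s (n + s) (k + s).
Proof.
rewrite /cq (eq_bigl (fun p : {perm 'I_(n + s)} => predT p &&
  ((#|porbits p| == (k + s)%N) && distinct_blocks s (porbits p)))) //.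
apply: (sum_csum (e := @enc_perm (n + s))).
- by move=> p _; rewrite enc_perm_canon enc_perm_head.
- by move=> p p' _ _; apply: enc_perm_inj.
- by move=> L cL hL; have [p <-] := enc_perm_surj cL hL; exists p.
- by [].
move=> p _; have cp := enc_perm_canon p; have pe := porbits_enc p.
by rewrite (card_canon pe cp)
  (distinct_blocks_canon (partition_porbits p) pe cp).
Qed.

(** * q-binomials and transfer of recurrences *)

Lemma qfact_neq0 n : qfact n != 0.
Proof. exact/monic_neq0/qfact_monic. Qed.

Lemma qbinom_small n k : (n < k)%N -> qbinom n k = 0.
Proof. by move=> h; rewrite /qbinom leqNgt h. Qed.

Lemma qbinomn0 n : qbinom n 0 = 1.
Proof.
apply: (mulIf (qfact_neq0 n)).
by rewrite mul1r -[in RHS](qbinomE (leq0n n)) subn0 qfact0 mul1r.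
Qed.

Lemma qbinomnn n : qbinom n n = 1.
Proof.
apply: (mulIf (qfact_neq0 n)).
by rewrite mul1r -[in RHS](qbinomE (leqnn n)) subnn qfact0 mulr1.
Qed.

(** Over this common denominator, each Pascal rule becomes a splitting of [n + 1] by [qnumD]. *)
Lemma qbinomS_mul n i : (i < n)%N ->
  qbinom n i.+1 * (qfact i.+1 * qfact (n - i)) = qfact n * qnum (n - i) /\
  qbinom n i * (qfact i.+1 * qfact (n - i)) = qfact n * qnum i.+1.
Proof.
move=> ltin; split; last by rewrite -(qbinomE (ltnW ltin)) qfactS; ring.
by rewrite -(qbinomE ltin) -(subnSK ltin) (qfactS (n - i.+1)); ring.
Qed.

(** From [n + 1] = [n - i] + q^(n - i) [i + 1]. *)
Lemma qbinom_pascal n i : (i <= n)%N ->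
  qbinom n.+1 i.+1 = qbinom n i.+1 + 'X^(n - i) * qbinom n i.
Proof.
rewrite leq_eqVlt => /orP[/eqP->|ltin].
  by rewrite !qbinomnn qbinom_small // subnn expr0 mulr1 add0r.
apply: (mulIf (mulf_neq0 (qfact_neq0 i.+1) (qfact_neq0 (n - i)))).
have [e1 e2] := qbinomS_mul ltin.
have := @qbinomE n.+1 i.+1 (ltnW ltin); rewrite subSS => ->.
rewrite mulrDl e1 -mulrA e2 qfactS.
have -> : n.+1 = (n - i + i.+1)%N by lia.
by rewrite qnumD; ring.
Qed.

(** From [n + 1] = [i + 1] + q^(i + 1) [n - i]. *)
Lemma qbinom_pascal' n i : (i <= n)%N ->
  qbinom n.+1 i.+1 = 'X^(i.+1) * qbinom n i.+1 + qbinom n i.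
Proof.
rewrite leq_eqVlt => /orP[/eqP->|ltin].
  by rewrite !qbinomnn qbinom_small // mulr0 add0r.
apply: (mulIf (mulf_neq0 (qfact_neq0 i.+1) (qfact_neq0 (n - i)))).
have [e1 e2] := qbinomS_mul ltin.
have := @qbinomE n.+1 i.+1 (ltnW ltin); rewrite subSS => ->.
rewrite mulrDl -mulrA e1 e2 qfactS.
have -> : n.+1 = (i.+1 + (n - i))%N by lia.
by rewrite qnumD; ring.
Qed.

Lemma qrisingS a b : qrising a b.+1 = qrising a b * qnum (a + b).
Proof. by rewrite /qrising addnS big_nat_recr ?leq_addr. Qed.

(** Induction on n: the Pascal-type rule for [coef] expresses row n + 1 through row n, with [f i]
    and [f i.+1]; after the recurrence of [f], the last two hypotheses match the coefficients with
    those in the recurrence of [g]. *)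
Lemma transfer_recurrence (g f coef alpha beta : nat -> nat -> {poly int})
    (u v u' v' : nat -> nat -> {poly int}) :
    (forall k, g 0%N k = coef 0%N 0%N * f 0%N k) ->
    (forall n k, g n.+1 k =
       (if k is k'.+1 then u n k' * g n k' else 0) + v n k * g n k) ->
    (forall n k, f n.+1 k =
       (if k is k'.+1 then u' n k' * f n k' else 0) + v' n k * f n k) ->
    (forall n, coef n n.+1 = 0) ->
    (forall n, coef n.+1 0%N = alpha n 0%N * coef n 0%N) ->
    (forall n i, (i <= n)%N ->
       coef n.+1 i.+1 = alpha n i.+1 * coef n i.+1 + beta n i * coef n i) ->
    (forall n i k, (i <= n)%N -> beta n i * u' i k = u n k) ->
    (forall n i k, (i <= n)%N -> alpha n i + beta n i * v' i k = v n k) ->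
  forall n k, g n k = \sum_(i < n.+1) coef n i * f i k.
Proof.
move=> g0 gS fS coef0 coefS0 coefSS hu hv.
elim=> [|n IH] k; first by rewrite big_ord1 g0.
have -> : \sum_(i < n.+2) coef n.+1 i * f i k =
    \sum_(i < n.+1) (alpha n i * coef n i * f i k +
                     beta n i * coef n i * f i.+1 k).
  rewrite big_split big_ord_recl /= coefS0.
  rewrite (eq_bigr (fun i : 'I_n.+1 => alpha n i.+1 * coef n i.+1 * f i.+1 k +
                     beta n i * coef n i * f i.+1 k)) => [|i _].
    rewrite big_split addrA /=; congr (_ + _).
    (* The top term has the factor [coef n n.+1], which vanishes; the shifted sum then fits the
       range i <= n again. *)
    rewrite big_ord_recr /= coef0 mulr0 mul0r addr0.
    by rewrite [RHS]big_ord_recl.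
  by rewrite /bump leq0n add1n coefSS ?mulrDl // -ltnS.
have hi (i : 'I_n.+1) : (i <= n)%N by rewrite -ltnS.
rewrite gS; case: k => [|k]; rewrite !IH !mulr_sumr ?add0r -?big_split /=;
  apply: eq_bigr => i _; rewrite fS -(hv n i) //; first by ring.
by rewrite -(hu n i) //; ring.
Qed.

Lemma bin2_add m r : 'C(m + r, 2) = ('C(m, 2) + 'C(r, 2) + m * r)%N.
Proof.
elim: r => [|r IH]; first by rewrite addn0 bin0n; lia.
by rewrite addnS !binS !bin1 IH; lia.
Qed.

(** The key identity is [m] + q^m [k + r] = [k + m + r], with the ordinary Pascal rule. *)
Lemma part_transfer (f : nat -> nat -> nat -> {poly int}) :
    (forall s k, f s 0%N k = if k == 0%N then 'X^('C(s, 2)) else 0) ->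
    (forall s n k, f s n.+1 k =
       (if k is k'.+1 then 'X^(k' + s) * f s n k' else 0) +
       qnum (k + s) * f s n k) ->
  forall m r n k, f (m + r)%N n k = \sum_(i < n.+1)
    'X^(m * (i + r) + 'C(m, 2)) * qnum m ^+ (n - i) * ('C(n, i))%:R * f r i k.
Proof.
move=> f0 fS m r.
apply: (@transfer_recurrence _ _
  (fun n i => 'X^(m * (i + r) + 'C(m, 2)) * qnum m ^+ (n - i) * ('C(n, i))%:R)
  (fun _ _ => qnum m) (fun _ _ => 'X^m) _ _ _ _ _ (fS _) (fS _)).
- move=> k /=; rewrite !f0; case: eqP;
  rewrite ?mulr0 // expr0 !mulr1 -exprD => _.
  by congr 'X^_; rewrite bin2_add; lia.
- by move=> n; rewrite (bin_small (ltnSn n)) mulr0.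
- by move=> n /=; rewrite !subn0 !bin0 exprS; ring.
- move=> n i le_in /=; rewrite (binS n) natrD mulrDr; congr (_ + _).
    (* For i = n the truncated [n - i.+1] spoils the exponent, but the binomial vanishes. *)
    rewrite subSS; have [->|ltin] := eqVneq i n;
      first by rewrite (bin_small (ltnSn n)) !mulr0.
    have -> : (n - i = (n - i.+1).+1)%N by lia.
    by rewrite exprS; ring.
  by rewrite subSS !mulrA -!exprD; congr ('X^_ * _ * _); lia.
- by move=> n i k _ /=; rewrite -exprD; congr 'X^_; lia.
- by move=> n i k _ /=; rewrite -qnumD; congr qnum; lia.
Qed.

(** With e = 2m + n - i, the key identity is [e] + q^e [i + k + 2r] = [n + k + 2m + 2r]. In q^e, the
    Pascal rule supplies q^(n - i) and the exponent of the coefficient supplies q^(2m). *)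
Lemma lah_transfer (f : nat -> nat -> nat -> {poly int}) :
    (forall s k, f s 0%N k = if k == 0%N then 'X^(s * (s - 1)) else 0) ->
    (forall s n k, f s n.+1 k =
       (if k is k'.+1 then 'X^((n + s) + (k' + s)) * f s n k' else 0) +
       qnum ((n + s) + (k + s)) * f s n k) ->
  forall m r n k, f (m + r)%N n k = \sum_(i < n.+1)
    'X^(m * (2 * i + 2 * r + m - 1)) * qrising (2 * m) (n - i) *
    qbinom n i * f r i k.
Proof.
move=> f0 fS m r.
apply: (@transfer_recurrence _ _
  (fun n i => 'X^(m * (2 * i + 2 * r + m - 1)) * qrising (2 * m) (n - i) *
    qbinom n i)
  (fun n i => qnum (2 * m + (n - i))) (fun n i => 'X^(2 * m + (n - i)))
  _ _ _ _ _ (fS _) (fS _)).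
- move=> k /=; rewrite !f0; case: eqP; rewrite ?mulr0 // => _.
  rewrite subnn qbinomnn /qrising addn0 big_geq // !mulr1 -exprD.
  by congr 'X^_; case: m r => [|m] [|r]; nia.
- by move=> n /=; rewrite qbinom_small // mulr0.
- by move=> n /=; rewrite !subn0 !qbinomn0 qrisingS; ring.
- move=> n i le_in /=; rewrite qbinom_pascal // mulrDr; congr (_ + _).
    rewrite subSS; have [->|ltin] := eqVneq i n;
      first by rewrite qbinom_small // !mulr0.
    have -> : (n - i = (n - i.+1).+1)%N by lia.
    by rewrite qrisingS; ring.
  (* The subtraction of 1 can only be truncated when m = 0, where the product vanishes anyway. *)
  have -> : (m * (2 * i.+1 + 2 * r + m - 1) =
             m * (2 * i + 2 * r + m - 1) + 2 * m)%N by case: m => //; nia.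
  by rewrite subSS !exprD; ring.
- by move=> n i k le_in /=; rewrite -exprD; congr 'X^_; lia.
- by move=> n i k le_in /=; rewrite -qnumD; congr qnum; lia.
Qed.

(** The key identity is [r + i] + q^(r + i) [m + n - i] = [n + m + r], which calls for the other
    Pascal rule. The factor 1 keeps the shape required by [transfer_recurrence]. *)
Lemma cycle_transfer (f : nat -> nat -> nat -> {poly int}) :
    (forall s k, f s 0%N k = if k == 0%N then 1 else 0) ->
    (forall s n k, f s n.+1 k =
       (if k is k'.+1 then 1 * f s n k' else 0) + qnum (n + s) * f s n k) ->
  forall m r n k, f (m + r)%N n k = \sum_(i < n.+1)
    'X^(r * (n - i)) * qrising m (n - i) * qbinom n i * f r i k.
Proof.
move=> f0 fS m r.
apply: (@transfer_recurrence _ _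
  (fun n i => 'X^(r * (n - i)) * qrising m (n - i) * qbinom n i)
  (fun n i => 'X^(r + i) * qnum (m + (n - i))) (fun _ _ => 1)
  _ _ _ _ _ (fS _) (fS _)).
- move=> k /=; rewrite !f0; case: eqP; rewrite ?mulr0 // => _.
  by rewrite subnn qbinomnn /qrising addn0 big_geq // muln0 !mulr1.
- by move=> n /=; rewrite qbinom_small // mulr0.
- by move=> n /=; rewrite !subn0 !qbinomn0 qrisingS mulnS addn0 exprD; ring.
- move=> n i le_in /=; rewrite qbinom_pascal' // mulrDr; congr (_ + _).
    rewrite subSS; have [->|ltin] := eqVneq i n;
      first by rewrite qbinom_small // !mulr0.
    have -> : (n - i = (n - i.+1).+1)%N by lia.
    by rewrite qrisingS mulnS !exprD; ring.
  by rewrite subSS mul1r.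
- by move=> n i k le_in /=; rewrite mul1r.
- move=> n i k le_in /=; rewrite mul1r addrC addnC -qnumD; congr qnum; lia.
Qed.

(** * Initial values and recurrences of the three families *)

Lemma Sq0 s k : Sq s 0 k = if k == 0%N then 'X^('C(s, 2)) else 0.
Proof.
rewrite Sq_csum (csum_base (a := fun _ K => K) (b := fun _ K => K)
  (fun N => isT) sorted_delete part_rcons part_insb) //.
rewrite -[X in _ == X]add0n eqn_add2r; case: eqP => // _; congr 'X^_.
by rewrite -bin2_sum big_mkord.
Qed.

Lemma SqS s n k :
  Sq s n.+1 k = (if k is k'.+1 then 'X^(k' + s) * Sq s n k' else 0) +
                qnum (k + s) * Sq s n k.
Proof.
rewrite !Sq_csum (csum_addS (a := fun _ K => K) (b := fun _ K => K)
  (fun N => isT) sorted_delete part_rcons part_insb) //.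
by case: k => // k; rewrite Sq_csum.
Qed.

Lemma Lq0 s k : Lq s 0 k = if k == 0%N then 'X^(s * (s - 1)) else 0.
Proof.
rewrite Lq_csum (csum_base (a := addn) (b := addn)
  (fun N => isT) (fun N c1 c2 _ _ _ => isT) lah_weight_rcons lah_insb) //;
    last by rewrite /lah_weight inv_nil.
rewrite -[X in _ == X]add0n eqn_add2r; case: eqP => // _; congr 'X^_.
(* The exponent to evaluate is the sum of j + j over j < s. *)
elim: s => [|s IH]; first by rewrite big_ord0.
by rewrite big_ord_recr /= IH; case: s {IH} => // s; nia.
Qed.

Lemma LqS s n k :
  Lq s n.+1 k =
    (if k is k'.+1 then 'X^((n + s) + (k' + s)) * Lq s n k' else 0) +
    qnum ((n + s) + (k + s)) * Lq s n k.
Proof.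
rewrite !Lq_csum (csum_addS (a := addn) (b := addn)
  (fun N => isT) (fun N c1 c2 _ _ _ => isT) lah_weight_rcons lah_insb) //;
    last by rewrite /lah_weight inv_nil.
by case: k => // k; rewrite Lq_csum.
Qed.

Lemma cq0 s k : cq s 0 k = if k == 0%N then 1 else 0.
Proof.
rewrite cq_csum (csum_base (a := fun _ _ => 0%N) (b := fun N _ => N)
  cycle_head_min1 cycle_head_min_delete cycle_rcons cycle_insb) ?inv_nil //.
rewrite -[X in _ == X]add0n eqn_add2r; case: eqP => // _.
by rewrite big1 ?expr0.
Qed.

Lemma cqS s n k :
  cq s n.+1 k = (if k is k'.+1 then 1 * cq s n k' else 0) +
                qnum (n + s) * cq s n k.
Proof.
rewrite !cq_csum (csum_addS (a := fun _ _ => 0%N) (b := fun N _ => N)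
  cycle_head_min1 cycle_head_min_delete cycle_rcons cycle_insb) ?inv_nil //.
by case: k => // k; rewrite cq_csum expr0.
Qed.

Theorem theorem2p7 (m n r k : nat) :
  [/\ Sq (m + r) n k =
        \sum_(0 <= i < n.+1)
           'X^(m * (i + r) + 'C(m, 2)) * qnum m ^+ (n - i) *
           ('C(n, i))%:R * Sq r i k,
      Lq (m + r) n k =
        \sum_(0 <= i < n.+1)
           'X^(m * (2 * i + 2 * r + m - 1)) * qrising (2 * m) (n - i) *
           qbinom n i * Lq r i k
    & cq (m + r) n k =
        \sum_(0 <= i < n.+1)
           'X^(r * (n - i)) * qrising m (n - i) * qbinom n i * cq r i k].
Proof.
rewrite !big_mkord; split.
- exact: part_transfer Sq0 SqS m r n k.
- exact: lah_transfer Lq0 LqS m r n k.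
- exact: cycle_transfer cq0 cqS m r n k.
Qed.
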